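(* Let $n\ge2$, let $\alpha_i=\langle\mu_{\alpha_i},\eta_{\alpha_i},\nu_{\alpha_i}\rangle$ ($i=1,\dots,n$) be picture fuzzy numbers, let $\omega=(\omega_1,\dots,\omega_n)^{\mathrm T}$ be the weight vector with $\omega_i\in(0,1]$ and $\sum_{i=1}^n\omega_i=1$, let $T$ be a strict t-norm with additive generator $\tau$, and let $\zeta(x)=\tau(1-x)$. Then for all $p,q>0$, $\mathrm{PFIWBM}_T^{p,q}(\alpha_1,\dots,\alpha_n)$ is a picture fuzzy number, and $$\mathrm{PFIWBM}_T^{p,q}(\alpha_1,\dots,\alpha_n)=\Big\langle\tau^{-1}\big(\tfrac1{p+q}\tau(\bar\mu)\big),\ \tau^{-1}\big(\tfrac1{p+q}\tau(\bar\eta+\bar\mu)\big)-\tau^{-1}\big(\tfrac1{p+q}\tau(\bar\mu)\big),\ \zeta^{-1}\big(\tfrac1{p+q}\zeta(\bar\nu)\big)\Big\rangle,$$ where (all sums being over ordered pairs $(i,j)$ with $1\le i,j\le n$, $i\ne j$) $$\bar\mu=\zeta^{-1}\Big(\tfrac1{n(n-1)}\sum_{i\ne j}\zeta\big(\tau^{-1}\big(p\,\tau(\zeta^{-1}(\omega_i\zeta(\mu_{\alpha_i})))+q\,\tau(\zeta^{-1}(\omega_j\zeta(\mu_{\alpha_j})))\big)\big)\Big),$$ $$\begin{aligned}\bar\eta=\ &\tau^{-1}\Big(\tfrac1{n(n-1)}\sum_{i\ne j}\tau\Big(\tau^{-1}\Big(p\,\tau\big(\tau^{-1}(\omega_i\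tau(\eta_{\alpha_i}+\nu_{\alpha_i}))-\tau^{-1}(\omega_i\tau(\nu_{\alpha_i}))+\zeta^{-1}(\omega_i\zeta(\mu_{\alpha_i}))\big)\\&\qquad+q\,\tau\big(\tau^{-1}(\omega_j\tau(\eta_{\alpha_j}+\nu_{\alpha_j}))-\tau^{-1}(\omega_j\tau(\nu_{\alpha_j}))+\zeta^{-1}(\omega_j\zeta(\mu_{\alpha_j}))\big)\Big)\\&\qquad-\tau^{-1}\big(p\,\tau(\zeta^{-1}(\omega_i\zeta(\mu_{\alpha_i})))+q\,\tau(\zeta^{-1}(\omega_j\zeta(\mu_{\alpha_j})))\big)\\&\qquad+\zeta^{-1}\big(p\,\zeta(\tau^{-1}(\omega_i\tau(\nu_{\alpha_i})))+q\,\zeta(\tau^{-1}(\omega_j\tau(\nu_{\alpha_j})))\big)\Big)\Big)\\&-\tau^{-1}\Big(\tfrac1{n(n-1)}\sum_{i\ne j}\tau\big(\zeta^{-1}\big(p\,\zeta(\tau^{-1}(\omega_i\tau(\nu_{\alpha_i})))+q\,\zeta(\tau^{-1}(\omega_j\tau(\nu_{\alpha_j})))\big)\big)\Big),\end{aligned}$$ $$\bar\nu=\tau^{-1}\Big(\tfrac1{n(n-1)}\sum_{i\ne j}\tau\big(\zeta^{-1}\big(p\,\zeta(\tau^{-1}(\omega_i\tau(\nu_{\alpha_i})))+q\,\zeta(\tau^{-1}(\omega_j\tau(\nu_{\alpha_j})))\big)\big)\Big).$$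
   Context: A picture fuzzy number (PFN) is a triple $\alpha=\langle\mu,\eta,\nu\rangle$ with $\mu,\eta,\nu\in[0,1]$ and $\mu+\eta+\nu\le1$. A t-norm is a commutative, associative map $T:[0,1]^2\to[0,1]$, nondecreasing in each variable, with $T(1,x)=x$. It is strict if it is continuous and $T(x,y)<T(x,z)$ whenever $x>0$ and $y<z$. A strict t-norm has a continuous additive generator: a continuous strictly decreasing bijection $\tau:[0,1]\to[0,+\infty]$ with $\tau(1)=0$, $\tau(0)=+\infty$ and $T(x,y)=\tau^{-1}(\tau(x)+\tau(y))$. Its dual t-conorm is $S(x,y)=1-T(1-x,1-y)=\zeta^{-1}(\zeta(x)+\zeta(y))$, where $\zeta(x)=\tau(1-x)$. Arithmetic in $[0,+\infty]$ is the usual one ($a+\infty=\infty$, $\lambda\cdot\infty=\infty$ for $\lambda>0$). For a strict t-norm $T$, PFNs $\alpha_k=\langle\mu_k,\eta_k,\nu_k\rangle$ ($k=1,2$), $\alpha=\langle\mu,\eta,\nu\rangle$ and $\lambda>0$ define: $\alpha_1\oplus\alpha_2=\langle S(\mu_1,\mu_2),\,T(\eta_1+\nu_1,\eta_2+\nu_2)-T(\nu_1,\nu_2),\,T(\nu_1,\nu_2)\rangle$; $\alpha_1\otimes\alpha_2=\langle T(\mu_1,\mu_2),\,T(\eta_1+\mu_1,\eta_2+\mu_2)-T(\mu_1,\mu_2),\,S(\nu_1,\nu_2)\rangle$; $\lambda\cdot\alpha=\langle\zeta^{-1}(\lambda\zeta(\mu)),\,\tau^{-1}(\lambda\tau(\eta+\nu))-\tau^{-1}(\lambda\tau(\nu)),\,\tau^{-1}(\lambda\tau(\nu))\rangle$;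 $\alpha^\lambda=\langle\tau^{-1}(\lambda\tau(\mu)),\,\tau^{-1}(\lambda\tau(\eta+\mu))-\tau^{-1}(\lambda\tau(\mu)),\,\zeta^{-1}(\lambda\zeta(\nu))\rangle$. These operations send PFNs to PFNs, and $\oplus,\otimes$ are commutative and associative (known facts), so iterated $\bigoplus$ is well defined. For $p,q>0$ the picture fuzzy interactional weighted Bonferroni mean induced by $T$ (with weight vector $\omega$) is $$\mathrm{PFIWBM}_T^{p,q}(\alpha_1,\dots,\alpha_n)=\Big[\tfrac1{n(n-1)}\cdot\bigoplus_{i,j=1,\ i\ne j}^n\big((\omega_i\cdot\alpha_i)^p\otimes(\omega_j\cdot\alpha_j)^q\big)\Big]^{\frac1{p+q}}.$$ *)

(* Defs.v *)
From HB Require Import structures.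
From mathcomp Require Import all_boot all_order all_algebra.
From mathcomp Require Import ring lra.
From mathcomp Require Import all_classical all_reals all_analysis.

Set Implicit Arguments.
Unset Strict Implicit.
Unset Printing Implicit Defensive.

Import Order.TTheory GRing.Theory Num.Theory.
Import numFieldNormedType.Exports.

Local Open Scope classical_set_scope.
Local Open Scope ring_scope.

(* Maps on [0,1] are represented by total functions on R whose values outside
   [0,1] are irrelevant: every axiom below is restricted to [0,1]. *)

Definition unit_itv (R : realType) : set R := `[0, 1]%classic.

Arguments unit_itv : clear implicits.

Record t_norm (R : realType) (T : R -> R -> R) : Prop := TNorm {
  tnorm_range : forall x y,
    unit_itv R x -> unit_itv R y -> unit_itv R (T x y);
  tnormC : forall x y,
    unit_itv R x -> unit_itv R y -> T x y = T y x;
  tnormA : forall x y z,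
    unit_itv R x -> unit_itv R y -> unit_itv R z ->
    T x (T y z) = T (T x y) z;
  tnorm_homo : forall x1 x2 y1 y2,
    unit_itv R x1 -> unit_itv R x2 -> unit_itv R y1 -> unit_itv R y2 ->
    x1 <= x2 -> y1 <= y2 -> T x1 y1 <= T x2 y2;
  tnorm1x : forall x, unit_itv R x -> T 1 x = x }.

Record strict_t_norm (R : realType) (T : R -> R -> R) : Prop := StrictTNorm {
  strict_tnorm : t_norm T;
  strict_tnorm_cts :
    {within unit_itv R `*` unit_itv R, continuous (fun z : R * R => T z.1 z.2)};
  strict_tnorm_lt : forall x y z,
    unit_itv R x -> unit_itv R y -> unit_itv R z ->
    0 < x -> y < z -> T x y < T x z }.

Definition t_conorm (R : realType) (T : R -> R -> R) (x y : R) : R :=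
  1 - T (1 - x) (1 - y).

(* The inverse [0,+oo] -> [0,1] of a bijection f : [0,1] -> [0,+oo]. *)
Definition gen_inv (R : realType) (f : R -> \bar R) : \bar R -> R :=
  'pinv_(fun=> 0) (unit_itv R) f.

Definition dual_gen (R : realType) (tau : R -> \bar R) (x : R) : \bar R :=
  tau (1 - x).

Record additive_generator (R : realType) (T : R -> R -> R) (tau : R -> \bar R) :
    Prop := AdditiveGenerator {
  gen_bij : set_bij (unit_itv R) [set y : \bar R | (0 <= y)%E] tau;
  gen_cts : {within unit_itv R, continuous tau};
  gen_decr : forall x y,
    unit_itv R x -> unit_itv R y -> x < y -> (tau y < tau x)%E;
  gen1 : tau 1 = 0%E;
  gen0 : tau 0 = +oo%E;
  genE : forall x y,
    unit_itv R x -> unit_itv R y -> T x y = gen_inv tau (tau x + tau y)%E }.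

Record triple (R : realType) := Triple { deg_pos : R; deg_neu : R; deg_neg : R }.

Definition is_pfn (R : realType) (a : triple R) : Prop :=
  [/\ unit_itv R (deg_pos a), unit_itv R (deg_neu a), unit_itv R (deg_neg a)
    & deg_pos a + deg_neu a + deg_neg a <= 1].

Definition pf_add (R : realType) (T : R -> R -> R) (a b : triple R) : triple R :=
  Triple (t_conorm T (deg_pos a) (deg_pos b))
         (T (deg_neu a + deg_neg a) (deg_neu b + deg_neg b) - T (deg_neg a) (deg_neg b))
         (T (deg_neg a) (deg_neg b)).

Definition pf_mul (R : realType) (T : R -> R -> R) (a b : triple R) : triple R :=
  Triple (T (deg_pos a) (deg_pos b))
         (T (deg_neu a + deg_pos a) (deg_neu b + deg_pos b) - T (deg_pos a) (deg_pos b))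
         (t_conorm T (deg_neg a) (deg_neg b)).

Definition pf_scale (R : realType) (tau : R -> \bar R) (l : R) (a : triple R) :
    triple R :=
  let zeta := dual_gen tau in
  Triple (gen_inv zeta (l%:E * zeta (deg_pos a))%E)
         (gen_inv tau (l%:E * tau (deg_neu a + deg_neg a)%R)%E
          - gen_inv tau (l%:E * tau (deg_neg a))%E)
         (gen_inv tau (l%:E * tau (deg_neg a))%E).

Definition pf_pow (R : realType) (tau : R -> \bar R) (a : triple R) (l : R) :
    triple R :=
  let zeta := dual_gen tau in
  Triple (gen_inv tau (l%:E * tau (deg_pos a))%E)
         (gen_inv tau (l%:E * tau (deg_neu a + deg_pos a)%R)%E
          - gen_inv tau (l%:E * tau (deg_pos a))%E)
         (gen_inv zeta (l%:E * zeta (deg_neg a))%E).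

Definition pf_zero (R : realType) : triple R := Triple 0 0 1.

Arguments pf_zero : clear implicits.

(* By this lemma, a big operator on pf_add with default value pf_zero is, over a
   nonempty range, the iterated sum of its terms alone. *)
Lemma pf_addx0 (R : realType) (T : R -> R -> R) (a : triple R) :
  t_norm T -> is_pfn a -> pf_add T a (pf_zero R) = a.
Proof.
move=> hT; case: a => m e v [] /=; rewrite /unit_itv /= !in_itv /=.
move=> /andP[m0 m1] /andP[e0 e1] /andP[v0 v1] hs.
have T1 x : 0 <= x -> x <= 1 -> T x 1 = x.
  by move=> x0 x1; rewrite (tnormC hT) ?(tnorm1x hT) //;
    rewrite /unit_itv /= in_itv /=; lra.
rewrite /pf_add /t_conorm /= subr0 add0r !T1 ?subKr ?addrK //; lra.
Qed.

Definition pfiwbm (R : realType) (T : R -> R -> R) (tau : R -> \bar R)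
    (p q : R) (n : nat) (w : 'I_n -> R) (alpha : 'I_n -> triple R) : triple R :=
  pf_pow tau
    (pf_scale tau (n%:R * (n%:R - 1))^-1
      (\big[pf_add T/pf_zero R]_(ij : 'I_n * 'I_n | ij.1 != ij.2)
         pf_mul T (pf_pow tau (pf_scale tau (w ij.1) (alpha ij.1)) p)
                  (pf_pow tau (pf_scale tau (w ij.2) (alpha ij.2)) q)))
    (p + q)^-1.

(* Main.v *)
(* The generators linearize the operations: addition and scaling act linearly on
   (zeta pos, tau (neu + neg), tau neg), multiplication and powers on
   (tau pos, tau (neu + pos), zeta neg). A triple is a picture fuzzy number iff
   0 <= neg <= neu + neg <= 1 - pos <= 1, a chain preserved by monotonicity. *)

Require Import Defs.
From HB Require Import structures.
From mathcomp Require Import all_boot all_order all_algebra.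
From mathcomp Require Import lra.
From mathcomp Require Import all_classical all_reals all_analysis.
Import Order.TTheory GRing.Theory Num.Theory.
Import numFieldNormedType.Exports.
Local Open Scope ring_scope.

Set Implicit Arguments.
Unset Strict Implicit.

(** * The unit interval and picture fuzzy numbers *)

Lemma unit_itvE (R : realType) (x : R) : unit_itv R x <-> 0 <= x <= 1.
Proof. by rewrite /unit_itv /= in_itv. Qed.

Lemma unit_itv_onem (R : realType) (x : R) :
  unit_itv R x -> unit_itv R (1 - x).
Proof. by move=> /unit_itvE hx; apply/unit_itvE; lra. Qed.

(** The upper bounds on single degrees follow from nonnegativity and the sum bound. This leaves four
    linear inequalities, the form that [lra] handles in the closure proofs. *)
Lemma is_pfnE (R : realType) (a : triple R) :
  is_pfn a <-> [/\ 0 <= deg_pos a, 0 <= deg_neu a, 0 <= deg_neg a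
                 & deg_pos a + deg_neu a + deg_neg a <= 1].
Proof.
split=> [[/unit_itvE ? /unit_itvE ? /unit_itvE ? ?]|[? ? ? ?]].
  by split; lra.
by split=> //; apply/unit_itvE; lra.
Qed.

(** The neutral components of the operations evaluate [T] and [tau] at these two sums, so both must
    lie in the domain where the axioms apply. *)
Lemma is_pfn_neuD (R : realType) (a : triple R) : is_pfn a ->
  unit_itv R (deg_neu a + deg_neg a) /\ unit_itv R (deg_neu a + deg_pos a).
Proof. by move=> /is_pfnE[? ? ? ?]; split; apply/unit_itvE; lra. Qed.

(** * The generator and its inverse *)

Lemma gen_ge0 (R : realType) (T : R -> R -> R) (tau : R -> \bar R) (x : R) :
  additive_generator T tau -> unit_itv R x -> (0 <= tau x)%E.
Proof. by move=> htau hx; have [/(_ x hx)] := gen_bij htau. Qed.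

Lemma gen_inv_itv (R : realType) (T : R -> R -> R) (tau : R -> \bar R)
    (y : \bar R) :
  additive_generator T tau -> (0 <= y)%E -> unit_itv R (gen_inv tau y).
Proof.
move=> htau hy.
by have [h _ _] := bijpinv_bij (fun=> 0) (gen_bij htau); exact: h.
Qed.

Lemma gen_invK (R : realType) (T : R -> R -> R) (tau : R -> \bar R)
    (y : \bar R) :
  additive_generator T tau -> (0 <= y)%E -> tau (gen_inv tau y) = y.
Proof.
move=> htau hy; have [_ _ hs] := gen_bij htau.
by apply: (surjpK (fun=> 0) hs); rewrite inE.
Qed.

Lemma genK (R : realType) (T : R -> R -> R) (tau : R -> \bar R) (x : R) :
  additive_generator T tau -> unit_itv R x -> gen_inv tau (tau x) = x.
Proof.
move=> htau hx; have [_ hi _] := gen_bij htau.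
by apply: (pinvKV (fun=> 0) hi); rewrite inE.
Qed.

Lemma gen_le (R : realType) (T : R -> R -> R) (tau : R -> \bar R) (x y : R) :
  additive_generator T tau -> unit_itv R x -> unit_itv R y ->
  x <= y -> (tau y <= tau x)%E.
Proof.
move=> htau hx hy; rewrite le_eqVlt => /predU1P[-> //|xy].
exact/ltW/(gen_decr htau).
Qed.

(** By contradiction: were the inverse images in the opposite strict order, applying the strictly
    decreasing [tau] to them would give [z < y]. *)
Lemma gen_inv_le (R : realType) (T : R -> R -> R) (tau : R -> \bar R)
    (y z : \bar R) :
  additive_generator T tau -> (0 <= y)%E -> (y <= z)%E ->
  gen_inv tau z <= gen_inv tau y.
Proof.
move=> htau y0 yz; have z0 := le_trans y0 yz.
rewrite leNgt; apply/negP.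
move=> /(gen_decr htau (gen_inv_itv htau y0) (gen_inv_itv htau z0)).
by rewrite !(gen_invK htau) // ltNge yz.
Qed.

(** * The dual generator *)

Lemma dual_gen_bij (R : realType) (T : R -> R -> R) (tau : R -> \bar R) :
  additive_generator T tau ->
  set_bij (unit_itv R) [set y : \bar R | (0 <= y)%E]%classic (dual_gen tau).
Proof.
move=> htau; have [hf hi hs] := gen_bij htau; split.
- by move=> x /unit_itv_onem; exact: hf.
- move=> x y; rewrite !inE => /unit_itv_onem hx /unit_itv_onem hy /hi.
  by rewrite !inE => /(_ hx hy); lra.
- move=> y /hs[x hx <-]; exists (1 - x); first exact: unit_itv_onem.
  by rewrite /dual_gen subKr.
Qed.

(** The point [1 - gen_inv tau y] is a preimage of [y] under the dual generator, and injectivity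
    makes it the only one in [0,1]. Facts about the inverse of [tau] thereby transfer to the
    dual. *)
Lemma dual_gen_invE (R : realType) (T : R -> R -> R) (tau : R -> \bar R)
    (y : \bar R) :
  additive_generator T tau -> (0 <= y)%E ->
  gen_inv (dual_gen tau) y = 1 - gen_inv tau y.
Proof.
move=> htau y0; have [_ hi _] := dual_gen_bij htau.
(* Here [y] is rewritten as [tau (1 - (1 - x))] with [x = gen_inv tau y], which is the dual
   generator at [1 - x]. *)
rewrite -{1}(gen_invK htau y0) -{1}(subKr 1 (gen_inv tau y)).
apply: (pinvKV (fun=> 0) hi); rewrite inE.
exact/unit_itv_onem/(gen_inv_itv htau).
Qed.

Lemma dual_gen_invK (R : realType) (T : R -> R -> R) (tau : R -> \bar R)
    (y : \bar R) :
  additive_generator T tau -> (0 <= y)%E ->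
  dual_gen tau (gen_inv (dual_gen tau) y) = y.
Proof.
by move=> htau y0; rewrite (dual_gen_invE htau) // /dual_gen subKr (gen_invK htau).
Qed.

(** * The t-norm and t-conorm in generator coordinates *)

Lemma gen_t_norm (R : realType) (T : R -> R -> R) (tau : R -> \bar R)
    (x y : R) :
  additive_generator T tau -> unit_itv R x -> unit_itv R y ->
  tau (T x y) = (tau x + tau y)%E.
Proof.
move=> htau hx hy; rewrite (genE htau) // (gen_invK htau) //.
by rewrite adde_ge0 // (gen_ge0 htau).
Qed.

Lemma dual_gen_t_conorm (R : realType) (T : R -> R -> R) (tau : R -> \bar R)
    (x y : R) :
  additive_generator T tau -> unit_itv R x -> unit_itv R y ->
  dual_gen tau (t_conorm T x y) = (dual_gen tau x + dual_gen tau y)%E.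
Proof.
move=> htau hx hy; rewrite /dual_gen /t_conorm subKr (gen_t_norm htau) //;
  exact: unit_itv_onem.
Qed.

Lemma t_conormE (R : realType) (T : R -> R -> R) (tau : R -> \bar R)
    (x y : R) :
  additive_generator T tau -> unit_itv R x -> unit_itv R y ->
  t_conorm T x y =
  gen_inv (dual_gen tau) (dual_gen tau x + dual_gen tau y)%E.
Proof.
move=> htau /unit_itv_onem hx /unit_itv_onem hy.
rewrite (dual_gen_invE htau) // ?adde_ge0 ?(gen_ge0 htau) //.
by rewrite /t_conorm (genE htau).
Qed.

(** * Closure of picture fuzzy numbers under the four operations *)

(* Negation exchanges the roles of pos and neg: it conjugates [pf_add] and
   [pf_scale] into [pf_mul] and [pf_pow]. *)
Definition pf_neg (R : realType) (a : triple R) : triple R :=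
  Triple (deg_neg a) (deg_neu a) (deg_pos a).

Lemma pf_mul_neg (R : realType) (T : R -> R -> R) (a b : triple R) :
  pf_mul T a b = pf_neg (pf_add T (pf_neg a) (pf_neg b)).
Proof. by []. Qed.

Lemma pf_pow_neg (R : realType) (tau : R -> \bar R) (a : triple R) (l : R) :
  pf_pow tau a l = pf_neg (pf_scale tau l (pf_neg a)).
Proof. by []. Qed.

Lemma is_pfn_neg (R : realType) (a : triple R) :
  is_pfn a -> is_pfn (pf_neg a).
Proof. by move=> /is_pfnE[? ? ? ?]; apply/is_pfnE; split=> //=; lra. Qed.

(** Monotonicity of [T] is used twice: from neg to neu + neg, which makes the new neutral degree
    nonnegative, and from neu + neg to 1 - pos, which gives the sum bound because [t_conorm] is the
    complement of [T] at complements. *)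
Lemma is_pfn_add (R : realType) (T : R -> R -> R) (a b : triple R) :
  t_norm T -> is_pfn a -> is_pfn b -> is_pfn (pf_add T a b).
Proof.
move=> hT ha hb.
have [[a1 _ a3 _] [b1 _ b3 _]] := (ha, hb).
have [[sa _] [sb _]] := (is_pfn_neuD ha, is_pfn_neuD hb).
have [ca cb] := (unit_itv_onem a1, unit_itv_onem b1).
move: ha hb => /is_pfnE[? ? ? ?] /is_pfnE[? ? ? ?].
have /unit_itvE ? := tnorm_range hT ca cb.
have /unit_itvE ? := tnorm_range hT a3 b3.
have : T (deg_neg a) (deg_neg b)
       <= T (deg_neu a + deg_neg a) (deg_neu b + deg_neg b).
  by apply: (tnorm_homo hT) => //; lra.
have : T (deg_neu a + deg_neg a) (deg_neu b + deg_neg b)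
       <= T (1 - deg_pos a) (1 - deg_pos b).
  by apply: (tnorm_homo hT) => //; lra.
by move=> ? ?; apply/is_pfnE; rewrite /pf_add /t_conorm /=; split; lra.
Qed.

Lemma is_pfn_mul (R : realType) (T : R -> R -> R) (a b : triple R) :
  t_norm T -> is_pfn a -> is_pfn b -> is_pfn (pf_mul T a b).
Proof.
move=> hT /is_pfn_neg ha /is_pfn_neg hb; rewrite pf_mul_neg.
by apply: is_pfn_neg; exact: is_pfn_add.
Qed.

Lemma is_pfn_scale (R : realType) (T : R -> R -> R) (tau : R -> \bar R)
    (l : R) (a : triple R) :
  additive_generator T tau -> 0 < l -> is_pfn a -> is_pfn (pf_scale tau l a).
Proof.
move=> htau l0 ha; have [a1 _ a3 _] := ha; have [sa _] := is_pfn_neuD ha.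
have ca := unit_itv_onem a1.
move: ha => /is_pfnE[? ? ? ?].
have l0' : (0 <= l%:E)%E by rewrite lee_fin ltW.
have t0 x : unit_itv R x -> (0 <= l%:E * tau x)%E.
  by move=> hx; rewrite mule_ge0 // (gen_ge0 htau).
have /unit_itvE ? := gen_inv_itv htau (t0 _ ca).
have /unit_itvE ? := gen_inv_itv htau (t0 _ a3).
(* Two order reversals, by [tau] and by its inverse, cancel; the resulting increasing map is applied
   to neg <= neu + neg <= 1 - pos. *)
have h x y : unit_itv R x -> unit_itv R y -> x <= y ->
    gen_inv tau (l%:E * tau x)%E <= gen_inv tau (l%:E * tau y)%E.
  move=> hx hy xy; apply: (gen_inv_le htau) => //; first exact: t0.
  by rewrite lee_wpmul2l // (gen_le htau).
have ? := h _ _ a3 sa ltac:(lra).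
have ? := h _ _ sa ca ltac:(lra).
apply/is_pfnE; rewrite /pf_scale /= (dual_gen_invE htau) ?t0 // /dual_gen.
by split; lra.
Qed.

Lemma is_pfn_pow (R : realType) (T : R -> R -> R) (tau : R -> \bar R)
    (a : triple R) (l : R) :
  additive_generator T tau -> 0 < l -> is_pfn a -> is_pfn (pf_pow tau a l).
Proof.
move=> htau l0 /is_pfn_neg ha; rewrite pf_pow_neg.
by apply: is_pfn_neg; exact: is_pfn_scale htau _ _.
Qed.

(** * Iterated sums in generator coordinates *)

Lemma pf_add_big (R : realType) (T : R -> R -> R) (tau : R -> \bar R)
    (I : Type) (s : seq I) (P : pred I) (F : I -> triple R) :
  t_norm T -> additive_generator T tau -> (forall i, P i -> is_pfn (F i)) ->
  let B := \big[pf_add T/pf_zero R]_(i <- s | P i) F i in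
  [/\ is_pfn B,
      dual_gen tau (deg_pos B) =
        (\sum_(i <- s | P i) dual_gen tau (deg_pos (F i)))%E,
      tau (deg_neu B + deg_neg B) =
        (\sum_(i <- s | P i) tau (deg_neu (F i) + deg_neg (F i))%R)%E
    & tau (deg_neg B) = (\sum_(i <- s | P i) tau (deg_neg (F i)))%E].
Proof.
(* Membership in the picture fuzzy numbers is part of the induction, since the generator identities
   hold only on [0,1]. *)
move=> hT htau hF /=; elim: s => [|i s [hB IH1 IH2 IH3]].
  (* At [pf_zero] all three coordinates equal [tau 1 = 0], the empty sum. *)
  rewrite !big_nil /= /dual_gen subr0 add0r (gen1 htau); split=> //.
  by apply/is_pfnE; rewrite /=; split; lra.
rewrite !big_cons; case: ifPn => // Pi.
have hi := hF i Pi; rewrite -IH1 -IH2 -IH3 {IH1 IH2 IH3}.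
set B := (X in is_pfn X) in hB *.
have [[i1 _ i3 _] [b1 _ b3 _]] := (hi, hB).
have [[si _] [sb _]] := (is_pfn_neuD hi, is_pfn_neuD hB).
split; first exact: is_pfn_add.
- exact: (dual_gen_t_conorm htau).
(* The term subtracted in the neutral degree of [pf_add] is its negative degree, so it cancels in
   neu + neg and a single value of [T] remains. *)
- by rewrite /= subrK (gen_t_norm htau).
- exact: (gen_t_norm htau).
Qed.

(** * The closed formula for the Bonferroni mean *)

Unset Implicit Arguments.
Set Strict Implicit.

Theorem theoremV1 (R : realType) (n : nat) (hn : (2 <= n)%N)
  (alpha : 'I_n -> triple R) (halpha : forall i, is_pfn (alpha i))
  (w : 'I_n -> R) (hw : forall i, 0 < w i <= 1) (hw1 : \sum_(i < n) w i = 1)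
  (T : R -> R -> R) (hT : strict_t_norm T)
  (tau : R -> \bar R) (htau : additive_generator T tau)
  (p q : R) (hp : 0 < p) (hq : 0 < q) :
  let zeta := dual_gen tau in
  let taui := gen_inv tau in
  let zetai := gen_inv zeta in
  let c := (n%:R * (n%:R - 1))^-1 : R in
  let r := (p + q)^-1 : R in
  let mubar :=
    zetai (c%:E * \sum_(ij : 'I_n * 'I_n | ij.1 != ij.2)
      zeta (
        taui (p%:E * tau (zetai ((w ij.1)%:E * zeta (deg_pos (alpha ij.1)))%E)
              + q%:E * tau (zetai ((w ij.2)%:E * zeta (deg_pos (alpha ij.2)))%E))%E))%E in
  let nubar :=
    taui (c%:E * \sum_(ij : 'I_n * 'I_n | ij.1 != ij.2)
      tau (
        zetai (p%:E * zeta (taui ((w ij.1)%:E * tau (deg_neg (alpha ij.1)))%E)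
               + q%:E * zeta (taui ((w ij.2)%:E * tau (deg_neg (alpha ij.2)))%E))%E))%E in
  let etabar :=
    taui (c%:E * \sum_(ij : 'I_n * 'I_n | ij.1 != ij.2)
      tau (
        taui (p%:E * tau (taui ((w ij.1)%:E * tau (deg_neu (alpha ij.1) + deg_neg (alpha ij.1))%R)%E
                         - taui ((w ij.1)%:E * tau (deg_neg (alpha ij.1)))%E
                         + zetai ((w ij.1)%:E * zeta (deg_pos (alpha ij.1)))%E)%R
              + q%:E * tau (taui ((w ij.2)%:E * tau (deg_neu (alpha ij.2) + deg_neg (alpha ij.2))%R)%E
                         - taui ((w ij.2)%:E * tau (deg_neg (alpha ij.2)))%E
                         + zetai ((w ij.2)%:E * zeta (deg_pos (alpha ij.2)))%E)%R)%E
        -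
        taui (p%:E * tau (zetai ((w ij.1)%:E * zeta (deg_pos (alpha ij.1)))%E)
              + q%:E * tau (zetai ((w ij.2)%:E * zeta (deg_pos (alpha ij.2)))%E))%E
        +
        zetai (p%:E * zeta (taui ((w ij.1)%:E * tau (deg_neg (alpha ij.1)))%E)
               + q%:E * zeta (taui ((w ij.2)%:E * tau (deg_neg (alpha ij.2)))%E))%E)%R)%E
    - taui (c%:E * \sum_(ij : 'I_n * 'I_n | ij.1 != ij.2)
        tau (
          zetai (p%:E * zeta (taui ((w ij.1)%:E * tau (deg_neg (alpha ij.1)))%E)
                 + q%:E * zeta (taui ((w ij.2)%:E * tau (deg_neg (alpha ij.2)))%E))%E))%E in
  is_pfn (pfiwbm T tau p q w alpha) /\
  pfiwbm T tau p q w alpha =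
    Triple (taui (r%:E * tau mubar)%E)
           (taui (r%:E * tau (etabar + mubar)%R)%E
            - taui (r%:E * tau mubar)%E)
           (zetai (r%:E * zeta nubar)%E).
Proof.
move=> zeta taui zetai c r mubar nubar etabar.
have c0 : 0 < c.
  (* Both [n] and [n - 1] are positive because [n] is at least 2. *)
  by rewrite invr_gt0 mulr_gt0 ?subr_gt0 ?ltr1n // ltr0n ltnW.
have r0 : 0 < r by rewrite invr_gt0 addr_gt0.
have hTn := strict_tnorm hT.
have hS i : is_pfn (pf_scale tau (w i) (alpha i)).
  by apply: (is_pfn_scale htau) => //; have /andP[] := hw i.
pose A i l := pf_pow tau (pf_scale tau (w i) (alpha i)) l.
have hA i l : 0 < l -> is_pfn (A i l).
  by move=> l0; apply: (is_pfn_pow htau).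
pose F (ij : 'I_n * 'I_n) := pf_mul T (A ij.1 p) (A ij.2 q).
have hF ij : is_pfn (F ij) by apply: is_pfn_mul => //; exact: hA.
have [hB B1 B2 B3] := pf_add_big (index_enum _) hTn htau
  (fun ij (_ : ij.1 != ij.2) => hF ij).
have tauM l x : 0 < l -> unit_itv R x -> (0 <= l%:E * tau x)%E.
  by move=> l0 hx; rewrite mule_ge0 ?(gen_ge0 htau) // lee_fin ltW.
(* The next three facts compute the coordinates of a power that [pf_mul] reads. Positivity of [l]
   keeps the scaled values in [0,+oo], where [gen_inv] is a true inverse. *)
have tauA_pos i l : 0 < l ->
    tau (deg_pos (A i l)) =
    (l%:E * tau (deg_pos (pf_scale tau (w i) (alpha i))))%E.
  by move=> l0; have [? _ _ _] := hS i; rewrite (gen_invK htau) // tauM.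
have tauA_neuD i l : 0 < l ->
    tau (deg_neu (A i l) + deg_pos (A i l)) =
    (l%:E * tau (deg_neu (pf_scale tau (w i) (alpha i))
               + deg_pos (pf_scale tau (w i) (alpha i)))%R)%E.
  move=> l0; have [_ ?] := is_pfn_neuD (hS i).
  by rewrite /= subrK (gen_invK htau) // tauM.
have zetaA_neg i l : 0 < l ->
    zeta (deg_neg (A i l)) =
    (l%:E * zeta (deg_neg (pf_scale tau (w i) (alpha i))))%E.
  move=> l0; have [_ _ ? _] := hS i.
  by apply: (dual_gen_invK htau); rewrite tauM //; exact: unit_itv_onem.
have F_pos ij : deg_pos (F ij) =
    taui (p%:E * tau (deg_pos (pf_scale tau (w ij.1) (alpha ij.1)))
        + q%:E * tau (deg_pos (pf_scale tau (w ij.2) (alpha ij.2))))%E.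
  have [[? _ _ _] [? _ _ _]] := (hA ij.1 p hp, hA ij.2 q hq).
  by rewrite /= (genE htau) // !tauA_pos.
have F_neg ij : deg_neg (F ij) =
    zetai (p%:E * zeta (deg_neg (pf_scale tau (w ij.1) (alpha ij.1)))
        + q%:E * zeta (deg_neg (pf_scale tau (w ij.2) (alpha ij.2))))%E.
  have [[_ _ ? _] [_ _ ? _]] := (hA ij.1 p hp, hA ij.2 q hq).
  by rewrite [LHS](t_conormE htau) // -/zeta !zetaA_neg.
(* The subtracted [deg_pos (F ij)] stays folded here; [F_pos] expands it later into the middle term
   of [etabar]. *)
have F_neu ij : deg_neu (F ij) =
    taui (p%:E * tau (deg_neu (pf_scale tau (w ij.1) (alpha ij.1))
                    + deg_pos (pf_scale tau (w ij.1) (alpha ij.1)))%R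
        + q%:E * tau (deg_neu (pf_scale tau (w ij.2) (alpha ij.2))
                    + deg_pos (pf_scale tau (w ij.2) (alpha ij.2)))%R)%E
    - deg_pos (F ij).
  have [_ ?] := is_pfn_neuD (hA ij.1 p hp).
  have [_ ?] := is_pfn_neuD (hA ij.2 q hq).
  by rewrite [LHS]/= (genE htau) // !tauA_neuD.
set B := \big[pf_add T/pf_zero R]_(ij <- _ | _) F ij in hB B1 B2 B3.
have hcB : is_pfn (pf_scale tau c B) by exact: is_pfn_scale htau _ _.
have Epos : deg_pos (pf_scale tau c B) = mubar.
  by rewrite /= B1; congr (gen_inv _ (_ * _)%E); apply: eq_bigr => ij _;
    rewrite F_pos.
have Eneg : deg_neg (pf_scale tau c B) = nubar.
  by rewrite /= B3; congr (gen_inv _ (_ * _)%E); apply: eq_bigr => ij _;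
    rewrite F_neg.
have Eneu : deg_neu (pf_scale tau c B) = etabar.
  (* The first sum runs over [tau] of neu + neg of [F ij], whose expansion is the three-term
     argument in [etabar]; the second sum is the one in [nubar]. *)
  rewrite /= B2 B3; congr (gen_inv _ (_ * _)%E - gen_inv _ (_ * _)%E);
    apply: eq_bigr => ij _; by rewrite ?F_neu ?F_neg ?F_pos.
have -> : pfiwbm T tau p q w alpha = pf_pow tau (pf_scale tau c B) r by [].
split; first exact: (is_pfn_pow htau).
by rewrite /pf_pow Epos Eneg Eneu.
Qed.
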